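(* Let $w$ be a finite word with $\mathcal{A}=\mathrm{Alph}(w)$, $|\mathcal{A}|\ge 2$, and let $m=\min\{K_w,R_w\}$, $M=\max\{K_w,R_w\}$. Then $|w|=R_w+K_w+|\mathcal{A}|-2$ if and only if the factor complexity of $w$ satisfies $C_w(0)=1$, $C_w(i)=|\mathcal{A}|+i-1$ for $1\le i\le m$, $C_w(i+1)=C_w(i)$ for $m\le i\le M-1$, and $C_w(i+1)=C_w(i)-1$ for $M\le i\le |w|$. Moreover, when these equivalent conditions hold, $C_w(R_w)=C_w(K_w)$ and the maximal value of $C_w$ is $m+|\mathcal{A}|-1$.
   Context: Words are finite sequences of letters; $|w|$ is the length and $\mathrm{Alph}(w)$ the set of letters of $w$. A factor is a contiguous subword (including the empty word). $C_w(n)$ is the number of distinct factors of $w$ of length $n$, with $C_w(n)=0$ for $n>|w|$. A factor $u$ of $w$ is right special if $ux$ is a factor of $w$ for at least two distinct letters $x$. $R_w$ is the smallest positive integer $r$ such that $w$ has no right special factor of length $r$; $K_w$ is the length of the shortest suffix of $w$ occurring exactly once in $w$. *)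

(* Defs.v *)
From mathcomp Require Import all_boot.

Set Implicit Arguments.
Unset Strict Implicit.
Unset Printing Implicit Defensive.

Section Words.
Variable T : eqType.
Implicit Types (w u v : seq T) (n i r k : nat).

Definition Alph w : seq T := undup w.

(* The index list is empty when n > size w. *)
Definition factors w n : seq (seq T) :=
  undup [seq take n (drop i w) | i <- iota 0 ((size w).+1 - n)].

Lemma factorsP w n u : (u \in factors w n) = infix u w && (size u == n).
Proof.
rewrite mem_undup; apply/mapP/andP => [[i]|[/infixP[s [s' ->]] /eqP <-]].
  rewrite mem_iota /= add0n => lti ->; split; last first.
    rewrite ltn_subRL ltnS in lti.
    by rewrite size_takel // size_drop -(leq_add2l i) subnKC ?[i + n]addnC //;
       apply: leq_trans (leq_addl _ _) lti.
  apply: infix_trans (prefixW (prefix_take _ _)) _.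
  by rewrite -{2}[w](cat_take_drop i) suffix_infix.
exists (size s); last by rewrite drop_size_cat // take_size_cat.
by rewrite mem_iota /= add0n ltn_subRL !size_cat ltnS addnA [size u + _]addnC leq_addr.
Qed.

Definition complexity w n : nat := size (factors w n).

(* Counting over [Alph w] loses nothing: if [rcons u x] is a factor of [w],
   then [x] occurs in [w]. *)
Definition right_special w u : bool :=
  infix u w && (2 <= count (fun x => infix (rcons u x) w) (Alph w)).

Lemma right_specialP w u :
  reflect (infix u w /\
           exists x y, [/\ x != y, infix (rcons u x) w & infix (rcons u y) w])
          (right_special w u).
Proof.
have memA x : infix (rcons u x) w -> x \in Alph w.
  move=> h; rewrite mem_undup; apply: (mem_subseq (infixW h)).
  by rewrite mem_rcons mem_head.
apply: (iffP andP) => -[uw h]; split=> //.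
  move: h; rewrite -size_filter.
  have := filter_uniq (fun x => infix (rcons u x) w) (undup_uniq w).
  have := mem_filter (fun x => infix (rcons u x) w) ^~ (undup w).
  rewrite /Alph; case: filter => [|x [|y s]] // memf /andP[xs _] _.
  exists x, y; split.
  - by apply: contraNneq xs => ->; rewrite mem_head.
  - by have := memf x; rewrite mem_head => /esym/andP[].
  - by have := memf y; rewrite !inE eqxx orbT => /esym/andP[].
case: h => x [y [xy xw yw]].
rewrite -size_filter; apply: (@uniq_leq_size _ [:: x; y]) => [|z].
  by rewrite /= inE xy.
by rewrite !inE => /orP[] /eqP->; rewrite mem_filter ?xw ?yw memA.
Qed.

Definition no_right_special w r : bool :=
  (0 < r) && ~~ has (right_special w) (factors w r).

Lemma ex_no_right_special w : exists r, no_right_special w r.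
Proof. by exists (size w).+1; rewrite /no_right_special /factors subnn. Qed.

Definition Rw w : nat := ex_minn (ex_no_right_special w).

Definition occurrences u w : nat :=
  count (fun i => prefix u (drop i w)) (iota 0 (size w).+1).

(* [drop (size w - k) w] is the suffix of [w] of length [k]. *)
Definition unrepeated_suffix w k : bool :=
  (k <= size w) && (occurrences (drop (size w - k) w) w == 1).

Lemma ex_unrepeated_suffix w : exists k, unrepeated_suffix w k.
Proof.
exists (size w); rewrite /unrepeated_suffix leqnn subnn drop0 /occurrences /=.
rewrite drop0 prefix_refl -[X in _ == X]addn0 eqn_add2l -leqn0 leqNgt -has_count.
apply/hasPn => i; rewrite mem_iota add1n ltnS => /andP[i0 iw].
apply/prefixP => -[s] /(congr1 size); rewrite size_cat size_drop => e.
have : size w - i < size w by rewrite ltn_subrL i0 (leq_trans i0 iw).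
by rewrite e ltnNge leq_addr.
Qed.

Definition Kw w : nat := ex_minn (ex_unrepeated_suffix w).

End Words.

(* Main.v *)
Require Import Defs.
From mathcomp Require Import all_boot.
From mathcomp Require Import zify.

(** Counting the right extensions of the factors of length [n] gives
    [C (n+1) - C n = s n - [K <= n]], where [s n] is the sum of [deg u - 1] over
    the right special factors [u] of length [n], which have [deg u] right
    extensions: a factor without right
    extension is an unrepeated suffix, and there is one exactly when [K <= n].
    As right special factors are closed under suffixes, [s n = 0] for [n >= R]
    and [s n >= 1] for [n < R].  Hence [E n = C n + max(n - K, 0)] starts at
    [E 1 = |A|], increases by at least one at each step up to [R], and is then
    constant with value [E (|w| + 1) = |w| + 1 - K].  The length is therefore
    [R + K + |A| - 2] exactly when all these increments are equal to one, which
    determines [C] completely. *)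

Section Complexity.
Variables (T : eqType) (w : seq T).
Implicit Types (u v : seq T) (n i k : nat).

(** * Right extensions of factors *)

Definition right_degree u := count (fun x => infix (rcons u x) w) (Alph w).

(** Since [0.-1 = 0], only right special factors contribute. *)
Definition right_excess n := \sum_(u <- factors w n) (right_degree u).-1.

Lemma infix_rcons_Alph u x : infix (rcons u x) w -> x \in Alph w.
Proof.
move=> h; rewrite mem_undup; apply: (mem_subseq (infixW h)).
by rewrite mem_rcons mem_head.
Qed.

Lemma infix_rconsl u x : infix (rcons u x) w -> infix u w.
Proof. exact/infix_trans/prefixW/prefix_rcons. Qed.

(** Splitting off the last letter is a bijection from the factors of length [n+1] to the pairs of a
    factor of length [n] and one of its right extensions. *)
Lemma complexityS n :
  complexity w n.+1 = \sum_(u <- factors w n) right_degree u.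
Proof.
pose ext u := [seq x <- Alph w | infix (rcons u x) w].
have -> : complexity w n.+1 = size [seq rcons u x | u <- factors w n, x <- ext u].
  apply/perm_size/uniq_perm; rewrite ?undup_uniq //.
    apply: allpairs_uniq_dep; rewrite ?undup_uniq //.
      by move=> u _; rewrite filter_uniq ?undup_uniq.
    by move=> [u x] [v y] _ _ /= /rcons_inj[-> ->].
  move=> v; rewrite factorsP; apply/andP/allpairsPdep => [[]|[u [x []]]].
    case/lastP: v => // u x h; rewrite size_rcons eqSS => un.
    exists u, x; rewrite factorsP (infix_rconsl _ _ h) un.
    by rewrite mem_filter h (infix_rcons_Alph u).
  rewrite factorsP mem_filter => /andP[_ un] /andP[h _] ->.
  by rewrite h size_rcons eqSS.
rewrite size_allpairs_dep sumnE big_map.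
by apply: eq_bigr => u _; rewrite size_filter.
Qed.

Lemma right_degree_eq0 u :
  reflect (forall x, ~~ infix (rcons u x) w) (right_degree u == 0).
Proof.
rewrite -leqn0 leqNgt -has_count; apply: (iffP hasPn) => h x //.
by apply/negP => hx; move: (h x (infix_rcons_Alph _ _ hx)); rewrite hx.
Qed.

(** * Unrepeated suffixes and the first difference of the complexity *)

(** Any occurrence of a suffix other than the final one is followed by a letter. *)
Lemma unrepeated_suffixE k :
  unrepeated_suffix w k =
  (k <= size w) && (right_degree (drop (size w - k) w) == 0).
Proof.
rewrite /unrepeated_suffix; case: leqP => //= kw.
set u := drop _ w; have su : size u = k by rewrite size_drop subKn.
have pu : prefix u (drop (size w - k) w) by rewrite prefix_refl.
rewrite /occurrences.
(* The index [size w - k] is isolated: it accounts for the final occurrence, so no other index may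
   match. *)
have -> : iota 0 (size w).+1 =
    iota 0 (size w - k) ++ (size w - k) :: iota (size w - k).+1 k.
  by rewrite -[_ :: _]/(iota (size w - k) k.+1) -iotaD; congr iota; lia.
rewrite count_cat /= pu add1n addnS eqSS -count_cat.
rewrite -leqn0 leqNgt -has_count.
apply/idP/right_degree_eq0 => [/hasPn h x|h].
  apply/negP => /infixP[s [s' e]].
  have sw : size w = size s + k.+1 + size s'.
    by rewrite e !size_cat size_rcons su addnA.
  have /h : size s \in iota 0 (size w - k) ++ iota (size w - k).+1 k.
    by rewrite mem_cat !mem_iota; lia.
  have -> : drop (size s) w = rcons u x ++ s' by rewrite e drop_size_cat.
  by rewrite cat_rcons prefix_prefix.
apply/hasPn => i ii; apply/negP => /prefixP[[|x t] e].
  have := congr1 size e; rewrite cats0 size_drop su.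
  by move: ii; rewrite mem_cat !mem_iota; lia.
have /negP[] := h x; apply/infixP; exists (take i w), t.
by rewrite cat_rcons -e cat_take_drop.
Qed.

Lemma unrepeated_suffix_le k n :
  k <= n <= size w -> unrepeated_suffix w k -> unrepeated_suffix w n.
Proof.
move=> /andP[kn nw]; rewrite !unrepeated_suffixE nw => /andP[_].
move=> /right_degree_eq0 h; apply/right_degree_eq0 => x; apply: contra (h x).
apply: infix_trans.
have -> : drop (size w - k) w = drop (n - k) (drop (size w - n) w).
  by rewrite drop_drop; congr drop; lia.
rewrite -{2}[drop (size w - n) w](cat_take_drop (n - k)) rcons_cat.
exact: suffix_infix.
Qed.

Lemma leq_Kw n : n <= size w -> (Kw w <= n) = unrepeated_suffix w n.
Proof.
rewrite /Kw; case: ex_minnP => k hk kmin nw; apply/idP/idP => [kn|]; last exact: kmin.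
by apply: unrepeated_suffix_le hk; rewrite kn.
Qed.

Lemma Kw_le : Kw w <= size w.
Proof. by rewrite /Kw; case: ex_minnP => k /andP[]. Qed.

Lemma Kw_gt0 : 0 < size w -> 0 < Kw w.
Proof.
move=> w0; rewrite ltnNge leq_Kw // unrepeated_suffixE /= subn0 drop_size.
have [x [s e]] : exists x s, w = x :: s by case: (w) w0 => // x s; exists x, s.
apply/negP => /right_degree_eq0/(_ x)/negP[].
by apply/infixP; exists [::], s.
Qed.

(** A factor without right extension can occur only at the end of [w], hence is the suffix of length
    [n]. *)
Lemma count_right_degree0 n : n <= size w ->
  count (fun u => right_degree u == 0) (factors w n) = (Kw w <= n).
Proof.
move=> nw; rewrite leq_Kw // unrepeated_suffixE nw /=.
set v := drop _ w; have sv : size v = n by rewrite size_drop subKn.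
have vw : v \in factors w n.
  rewrite factorsP sv eqxx andbT -[w in infix _ w](cat_take_drop (size w - n)).
  exact: suffix_infix.
have deg0 u : u \in factors w n -> right_degree u == 0 -> u = v.
  rewrite factorsP => /andP[/infixP[s [[|x t] e]] /eqP un] /right_degree_eq0 h.
    by rewrite /v e cats0 size_cat un addnK drop_size_cat.
  by have /negP[] := h x; apply/infixP; exists s, t; rewrite cat_rcons.
case: (boolP (right_degree v == 0)) => hv.
  transitivity (count_mem v (factors w n)); last first.
    by rewrite count_uniq_mem ?undup_uniq // vw.
  by apply: eq_in_count => u uw /=; apply/idP/eqP => [|-> //]; exact: deg0.
apply/eqP; rewrite -leqn0 leqNgt -has_count; apply/hasPn => u uw.
by apply/negP => hu; move: hv; rewrite -(deg0 u) ?hu.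
Qed.

Lemma complexity_step n : n <= size w ->
  complexity w n.+1 + (Kw w <= n) = complexity w n + right_excess n.
Proof.
move=> nw; rewrite -count_right_degree0 // complexityS -sum1_count.
rewrite [X in _ + X]big_mkcond /=.
rewrite /right_excess.
have -> : complexity w n = \sum_(u <- factors w n) 1 by rewrite sum1_size.
rewrite -!big_split /=.
(* Termwise this is [d + [d = 0] = 1 + d.-1]. *)
by apply: eq_bigr => u _; case: (right_degree u) => //= d; lia.
Qed.

(** * Right special factors and [Rw] *)

Lemma right_excess_gt0 n :
  (0 < right_excess n) = has (right_special w) (factors w n).
Proof.
rewrite /right_excess lt0n sum_nat_seq_neq0; apply: eq_in_has => u /=.
rewrite factorsP /right_special => /andP[-> _] /=.
by rewrite -/(right_degree u); case: (right_degree u) => [|[]].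
Qed.

Lemma right_special_drop u k : right_special w u -> right_special w (drop k u).
Proof.
have ext x : infix (rcons u x) w -> infix (rcons (drop k u) x) w.
  apply: infix_trans; rewrite -{2}[u](cat_take_drop k) rcons_cat.
  exact: suffix_infix.
move=> /right_specialP[_ [x [y [xy /ext hx /ext hy]]]]; apply/right_specialP.
by split; [exact: infix_rconsl hx | exists x, y].
Qed.

Lemma right_excess_Rw n : Rw w <= n -> right_excess n = 0.
Proof.
rewrite /Rw; case: ex_minnP => r /andP[_ /hasPn hr] _ rn.
apply/eqP; rewrite -leqn0 leqNgt right_excess_gt0; apply/hasPn => u.
rewrite factorsP => /andP[uw /eqP un]; apply/negP => hu.
(* The suffix of [u] of length [r] would be right special as well. *)
have := right_special_drop u (n - r) hu; apply/negP/hr.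
rewrite factorsP size_drop un subKn // eqxx andbT.
apply: infix_trans uw; rewrite -{2}[u](cat_take_drop (n - r)).
exact: suffix_infix.
Qed.

Lemma right_excess_lt_Rw n : 0 < n < Rw w -> 0 < right_excess n.
Proof.
rewrite /Rw; case: ex_minnP => r _ rmin /andP[n0 nr].
rewrite right_excess_gt0; apply: contraLR nr => h.
by rewrite -leqNgt rmin // /no_right_special n0.
Qed.

Lemma Rw_gt0 : 0 < Rw w.
Proof. by rewrite /Rw; case: ex_minnP => r /andP[]. Qed.

(** A right special factor of length [|w|] would extend to a factor longer than [w]. *)
Lemma Rw_le : 0 < size w -> Rw w <= size w.
Proof.
move=> w0; rewrite /Rw; case: ex_minnP => r _; apply; rewrite /no_right_special w0.
apply/hasPn => u; rewrite factorsP => /andP[_ /eqP un]; apply/negP.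
move=> /right_specialP[_ [x [y [_ /size_infix + _]]]].
by rewrite size_rcons un ltnn.
Qed.

(** * Boundary values and the adjusted complexity *)

Lemma complexity0 : complexity w 0 = 1.
Proof.
apply/eqP; rewrite eqn_leq; apply/andP; split.
  apply: (@uniq_leq_size _ _ [:: [::]]); rewrite ?undup_uniq // => u.
  by rewrite factorsP => /andP[_]; case: u.
by rewrite /complexity lt0n size_eq0; apply/eqP => e; have := factorsP w 0 [::];
   rewrite e infix0s.
Qed.

Lemma complexity1 : complexity w 1 = size (Alph w).
Proof.
have f0 : factors w 0 = [:: [::]].
  have := complexity0; rewrite /complexity.
  case e: (factors w 0) => [|u [|]] // _; congr [:: _].
  by have := factorsP w 0 u; rewrite e mem_head => /esym/andP[_]; case: u e.
rewrite complexityS f0 big_seq1; apply/eqP; rewrite -all_count.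
apply/allP => x; rewrite mem_undup /= => /path.splitPr[s t].
by apply/infixP; exists s, t.
Qed.

Lemma complexity_gt_size n : size w < n -> complexity w n = 0.
Proof.
move=> wn; rewrite /complexity /factors.
by have -> : (size w).+1 - n = 0 by lia.
Qed.

(** The truncated difference [n - Kw w] cancels the loss of one at each step from [Kw w] to
    [size w], leaving [right_excess] as the increment. *)
Definition adjusted_complexity n := complexity w n + (n - Kw w).

Lemma adjusted_complexityS n : n <= size w ->
  adjusted_complexity n.+1 = adjusted_complexity n + right_excess n.
Proof.
by move=> /complexity_step; rewrite /adjusted_complexity; case: leqP; lia.
Qed.

Lemma adjusted_complexity_const n : Rw w <= n <= (size w).+1 ->
  adjusted_complexity n = (size w).+1 - Kw w.
Proof.
move=> /andP[Rn nw].
have const d : n + d <= (size w).+1 ->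
    adjusted_complexity (n + d) = adjusted_complexity n.
  elim: d => [|d IHd] ndw; first by rewrite addn0.
  rewrite addnS adjusted_complexityS; last by lia.
  by rewrite right_excess_Rw ?addn0 ?IHd //; lia.
(* At [|w| + 1] the complexity vanishes, which fixes the constant. *)
rewrite -(const ((size w).+1 - n)); last by lia.
by rewrite subnKC // /adjusted_complexity complexity_gt_size.
Qed.

Lemma adjusted_complexity_growth i d : 0 < i -> i + d <= Rw w -> Rw w <= size w ->
  adjusted_complexity i + d <= adjusted_complexity (i + d).
Proof.
move=> i0 + Rs; elim: d => [|d IHd] idR; first by rewrite !addn0.
rewrite addnS [i + _]addnS adjusted_complexityS; last by lia.
have := right_excess_lt_Rw (i + d); lia.
Qed.

(* If the total growth between [1] and [R] is minimal, then so is each step. *)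
Lemma complexity_closed_form n : 0 < size w ->
    size w = Rw w + Kw w + size (Alph w) - 2 -> 0 < n <= (size w).+1 ->
  complexity w n + (n - Kw w) = size (Alph w) + minn n (Rw w) - 1.
Proof.
move=> w0 sw /andP[n0 nw]; rewrite -/(adjusted_complexity n).
have Rs := Rw_le w0; have R0 := Rw_gt0; have Ks := Kw_le; have K0 := Kw_gt0 w0.
have E1 : adjusted_complexity 1 = size (Alph w).
  by rewrite /adjusted_complexity complexity1; lia.
have ER : adjusted_complexity (Rw w) = (size w).+1 - Kw w.
  by apply: adjusted_complexity_const; lia.
have [nR|Rn] := leqP n (Rw w); last by rewrite adjusted_complexity_const; lia.
(* Growth from [1] to [n] bounds the value at [n] from below, growth from [n] to [Rw w] from above;
   the length hypothesis makes the bounds agree. *)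
have := @adjusted_complexity_growth 1 (n - 1).
have := @adjusted_complexity_growth n (Rw w - n).
rewrite !subnKC //; lia.
Qed.

End Complexity.

Theorem theorem2p2 (T : eqType) (w : seq T) (hA : 2 <= size (Alph w)) :
  let C := complexity w in
  let a := size (Alph w) in
  let m := minn (Kw w) (Rw w) in
  let M := maxn (Kw w) (Rw w) in
  (size w = Rw w + Kw w + a - 2 <->
     [/\ C 0 = 1,
         forall i, 1 <= i <= m -> C i = a + i - 1,
         forall i, m <= i <= M - 1 -> C (i + 1) = C i
       & forall i, M <= i <= size w -> C (i + 1) + 1 = C i])
  /\ (size w = Rw w + Kw w + a - 2 ->
        C (Rw w) = C (Kw w)
        /\ (exists n, C n = m + a - 1)
        /\ (forall n, C n <= m + a - 1)).
Proof.
move=> C a m M.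
have w0 : 0 < size w by apply: leq_trans (size_undup w); apply: leq_trans hA.
have Rs := Rw_le _ _ w0; have R0 := Rw_gt0 _ w.
have Ks := Kw_le _ w; have K0 := Kw_gt0 _ _ w0.
have closed := complexity_closed_form _ w ^~ w0.
rewrite -/a in hA closed; rewrite -/C in closed.
have C0 : C 0 = 1 := complexity0 _ w.
have Cbig n : size w < n -> C n = 0 := @complexity_gt_size _ w n.
split; [split|].
- move=> sw; split=> // i ii.
  + by have := closed i sw; lia.
  + by have := closed i sw; have := closed (i + 1) sw; lia.
  (* The case [i = size w] uses the closed form at [size w + 1]. *)
  + by have := closed i sw; have := closed (i + 1) sw; lia.
- move=> [_ inc cst dec].
  have Cm : C m = a + m - 1 by apply: inc; lia.
  have CM d : m + d <= M -> C (m + d) = C m.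
    elim: d => [|d IHd] dM; first by rewrite addn0.
    by rewrite addnS -addn1 cst ?IHd; lia.
  have Cend d : M + d <= (size w).+1 -> C (M + d) + d = C M.
    elim: d => [|d IHd] dM; first by rewrite !addn0.
    have -> : M + d.+1 = M + d + 1 by lia.
    by have := dec (M + d); lia.
  (* Descending by ones from [C M = a + m - 1] to [C (|w| + 1) = 0] gives [|w| + 1 - M = a + m - 1],
     and [m + M = Rw w + Kw w]. *)
  have := CM (M - m); have := Cend ((size w).+1 - M).
  have mM : m <= M by lia.
  have Mw : M <= (size w).+1 by lia.
  rewrite !subnKC // Cbig //; lia.
- move=> sw; split; last split.
  + by have := closed (Rw w) sw; have := closed (Kw w) sw; lia.
  + by exists m; have := closed m sw; lia.
  + move=> n; have := Cbig n; have := closed n sw.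
    (* The closed form starts at [1], so [n = 0] is treated separately. *)
    by case: n => [|n]; [rewrite C0; lia | lia].
Qed.
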